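(* Let $\mathsf f$ be a complexity function and let $(w_a,p_a),(w_b,p_b)$ be pairs in the $\mathsf f$-Teaching Book, with $p_a,p_b$ in $L$ and $p_a\nvDash_{\mathsf f}w_b$. Consider the library $B=\{p_a\}$. Let $p_b'$ be a program of $L_B$ equivalent to $p_b$, with $p_b'\vDash_{\mathsf f}w_b$. Then the cardinality of $\mathbb I_{w_b}^{\mathsf f}(p_b'|B)$ is bounded by $$\sum_{i}\Big(\sum_{j}\binom{i-\dot\ell(p_a)\cdot j+j}{j}\cdot(|\Upsilon|-1)^{\,i-j\cdot\dot\ell(p_a)}\Big),$$ where $i,j\in\mathbb N$ range over the intervals $i_{min}\le i\le i_{max}$ and $j_{min}\le j\le j_{max}$ given as follows: (1) if $1<\dot\ell(p_a)<\dot\ell(p_b)$: $i_{min}=\dot\ell(p_b)$, $i_{max}=1+(\dot\ell(p_b')-1)\cdot\dot\ell(p_a)$, $j_{min}=\Big\lceil\frac{i-\dot\ell(p_b')}{\dot\ell(p_a)-1}\Big\rceil$ and $j_{max}=\Big\lfloor\frac{i}{\dot\ell(p_a)}\Big\rfloor$; (2) if $\dot\ell(p_a)\ge\dot\ell(p_b)$: $i_{min}=\dot\ell(p_a)+1$, and $i_{max},j_{min},j_{max}$ are given by the same formulas as in (1).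
   Context: Languages and programs. $L$ is a universal (Turing-complete) language whose programs are finite sequences of instructions from a finite alphabet $\Upsilon$, each instruction coded with the same number $\log_2|\Upsilon|$ of bits. Let $\Sigma=\{0,1\}^*$. For a program $p$, $\dot\ell(p)$ is its length in number of instructions and $\ell(p)$ its length in bits. $\prec$ is the total order on programs given first by length and then, for equal length, by lexicographic order over $\Upsilon$. A program $p$ computes a map $\Sigma\to\Sigma\cup\{\perp\}$, where $p(\mathtt i)=\perp$ means that $p$ does not halt on $\mathtt i$. Two programs are equivalent if they compute the same function. An $L$-concept is a function $c:\Sigma\to\Sigma\cup\{\perp\}$ computed by at least one program of $L$; $C_L$ is the set of $L$-concepts and $[c]_L$ the set of programs of $L$ computing $c$. Libraries. A library is a finite set $B$ of programs (primitives). $\Upsilon$ always includes an instruction $@$ for static library calls, and $@$ is the last instruction in the lexicographic order. When $|B|=1$ the call to the unique primitive is the single instruction $@$ (one instruction, $\log_2|\Upsilon|$ bits). $L_B$ is the language $L$ with static calls to $B$. Examples. $X=\Sigma\times(\Sigma\cup\{\perp\})$. An example set is a finite subset $S$ of $X$ without different outputs for equal inputs. $\delta(S)$ is the number of bits of the encoding of $S$ by a fixed prefix (self-delimiting) code. $\lessdot$ is a fixed total order on example sets such that $S\lessdot S'$ implies $\delta(S)\le\delta(S')$. Time-bounded compatibility. $\lambda_L(\mathtt i,S)$ is a time bound (in steps, for input $\mathtt i$), of the form $\rho\cdot\min\{\ell(\mathtt i),\ell(\mathtt i_{max})\}+\ell(\mathtt o_{max})$ with $\rho$ a constant and $\mathtt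 i_{max},\mathtt o_{max}$ the longest input and output in $S$, that suffices for a program hard-coding $S$ as a trie (lookup table). A complexity function is a function $\mathsf f:\mathbb N\to\mathbb N$ acting as a time bound. $p\vDash_{\mathsf f}S$ means that for each $\langle \mathtt i,\mathtt o\rangle\in S$, within $\max\{\mathsf f(\ell(\mathtt i)),\lambda_L(\mathtt i,S)\}$ time steps, $p$ on input $\mathtt i$ outputs $\mathtt o$ if $\mathtt o\ne\perp$, and does not halt if $\mathtt o=\perp$. Learner, teacher, Teaching Book. $\Phi_\ell^{\mathsf f}(S)$ is the $\prec$-first program $p$ of $L$ with $p\vDash_{\mathsf f}S$. $\Omega_\ell^{\mathsf f}(c)$ is the $\lessdot$-first example set $S$ with $\Phi_\ell^{\mathsf f}(S)\in[c]_L$. The $\mathsf f$-Teaching Book consists of the pairs $(w_c,p_c)$ with $w_c=\Omega_\ell^{\mathsf f}(c)$ and $p_c=\Phi_\ell^{\mathsf f}(w_c)\in[c]_L$, for those concepts $c$ for which such a witness set exists; no program and no witness set is repeated. Interposed programs. For an example set $w$, a library $B$ and a program $p$ of $L_B$ with $p\vDash_{\mathsf f}w$, the $\mathbb I$-set is $$\mathbb I_w^{\mathsf f}(p|B)=\{q\text{ in }L_B:\ q\vDash_{\mathsf f}w\text{ and }q\prec p\}.$$ In the sum, $i$ plays the role of the number of instructions of the unfolded version of $q$ (each call $@$ replaced by the instructions of the called primitive) and $j$ the number of library calls in $q$.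
   Formalization: In case (2) the formal theorem additionally assumes that p_b does not strictly precede p_b' in the order ≺; without this p_b itself may be interposed with unfolded length below i_min, and the stated bound can fail (it can even be 0). *)

(* Defs.v *)
From HB Require Import structures.
From mathcomp Require Import all_boot all_order all_algebra.
From mathcomp Require Import finmap.
From mathcomp Require Import boolp classical_sets functions cardinality.

Set Implicit Arguments.
Unset Strict Implicit.
Unset Printing Implicit Defensive.

Import Order.TTheory GRing.Theory Num.Theory.

(* Partial functions Sigma -> Sigma + {bot} are total functions into
   [option word]; [None] is bot. *)
Definition word := seq bool.

(** Partial computable functions *)

(* Deterministic one-tape machine over {0, 1, blank}, with blank = None.
   A transition gives the new state, the symbol written and the direction
   (true = right); the absence of a transition halts the machine. *)
Record turing_machine := TuringMachine {
  tm_size : nat;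
  tm_delta : 'I_tm_size.+1 -> option bool ->
             option ('I_tm_size.+1 * option bool * bool) }.

(* State, tape to the left of the head (nearest cell first), and tape from the
   scanned cell rightwards; unlisted cells are blank. *)
Definition tm_config (M : turing_machine) : Type :=
  ('I_(tm_size M).+1 * seq (option bool) * seq (option bool))%type.

Definition tm_step (M : turing_machine) (c : tm_config M) :
    option (tm_config M) :=
  let: (q, l, r) := c in
  if tm_delta q (head None r) is Some (q', a, rightward) then
    Some (if rightward then (q', a :: l, behead r)
          else (q', behead l, head None l :: a :: behead r))
  else None.

Definition tm_init (M : turing_machine) (i : word) : tm_config M :=
  (ord0, [::], map Some i).

Fixpoint tm_read (r : seq (option bool)) : word :=
  if r is Some b :: r' then b :: tm_read r' else [::].

Definition tm_halts_with (M : turing_machine) (i o : word) : Prop :=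
  exists n (c : tm_config M),
    [/\ iter n (obind (@tm_step M)) (Some (tm_init M i)) = Some c,
        tm_step c = None
      & tm_read c.2 = o].

Definition partial_computable (c : word -> option word) : Prop :=
  exists M, forall i o, c i = Some o <-> tm_halts_with M i o.

(** Example sets *)

Definition functional_set (S : {fset word * option word}) : bool :=
  [forall x : S, forall y : S,
     ((val x).1 == (val y).1) ==> ((val x).2 == (val y).2)].

Record example_set := ExampleSet {
  examples :> {fset word * option word};
  examples_functional : functional_set examples }.

(* bot has length 0. *)
Definition output_length (o : option word) : nat := size (odflt [::] o).

(* Length of the longest input, resp. output; 0 on the empty example set. *)
Definition max_input (S : example_set) : nat :=
  \max_(x <- examples S) size x.1.
Definition max_output (S : example_set) : nat :=
  \max_(x <- examples S) output_length x.2.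

Definition trie_bound (rho : nat) (i : word) (S : example_set) : nat :=
  rho * minn (size i) (max_input S) + max_output S.

(* [ex_lt] is the strict order on example sets; [size (ex_code S)] is the
   number of bits of the self-delimiting encoding of S. *)
Record example_coding := ExampleCoding {
  ex_code : example_set -> word;
  ex_code_prefix_free : forall S S',
    prefix (ex_code S) (ex_code S') -> S = S';
  ex_lt : example_set -> example_set -> Prop;
  ex_lt_irr : forall S, ~ ex_lt S S;
  ex_lt_trans : forall S1 S2 S3, ex_lt S1 S2 -> ex_lt S2 S3 -> ex_lt S1 S3;
  ex_lt_total : forall S S', S <> S' -> ex_lt S S' \/ ex_lt S' S;
  ex_lt_code : forall S S',
    ex_lt S S' -> (size (ex_code S) <= size (ex_code S'))%N }.

(** Languages *)

(* An execution halting with output o after t steps is [Some (o, t)], and a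
   non-halting one is [None]. *)
Definition behaviour := word -> option (word * nat).

Definition denotation (b : behaviour) (i : word) : option word :=
  omap fst (b i).

(* The output on i within T steps, [None] if there is none. *)
Definition output_within (b : behaviour) (i : word) (T : nat) : option word :=
  if b i is Some (o, t) then if (t <= T)%N then Some o else None else None.

(* The programs of L itself are the call-free sequences; [exec] is irrelevant
   on the others. *)
Record language d (U : finOrderType d) := Language {
  call : U;
  call_last : forall x : U, (x <= call)%O;
  exec : seq U -> behaviour;
  rho : nat;
  turing_complete : forall c, partial_computable c ->
    exists2 p : seq U, call \notin p & denotation (exec p) =1 c;
  trie_programs : forall S : example_set,
    exists2 p : seq U, call \notin p &
      forall i o, (i, o) \in examples S ->
        if o is Some _ then output_within (exec p) i (trie_bound rho i S) = o
        else exec p i = None }.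

Section Teaching.
Context d (U : finOrderType d) (L : language U).
Implicit Types (p q pa : seq U) (f : nat -> nat) (S w : example_set).

Definition in_L p : bool := call L \notin p.

Definition prog_lt p q : bool :=
  (size p < size q)%N ||
  ((size p == size q) && ((p : seqlexi U) < (q : seqlexi U))%O).

Definition compatible f (b : behaviour) S : Prop :=
  forall i o, (i, o) \in examples S ->
    output_within b i (maxn (f (size i)) (trie_bound (rho L) i S)) = o.

Definition concept_class (c : word -> option word) : set (seq U) :=
  [set p | in_L p /\ denotation (exec L p) =1 c]%classic.

Definition is_concept (c : word -> option word) : Prop :=
  exists p, concept_class c p.

(* p is the prog_lt-first program of L compatible with S *)
Definition learner f S p : Prop :=
  [/\ in_L p, compatible f (exec L p) S
    & forall q, in_L q -> compatible f (exec L q) S -> ~~ prog_lt q p].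

(* S is the first example set from which the learner identifies c *)
Definition teacher (E : example_coding) f (c : word -> option word) S : Prop :=
  (exists2 p, learner f S p & concept_class c p) /\
  (forall S', ex_lt E S' S ->
     ~ exists2 p, learner f S' p & concept_class c p).

Definition teaching_book (E : example_coding) f w p : Prop :=
  exists c, [/\ is_concept c, teacher E f c w, learner f w p
              & concept_class c p].

(* Programs of L_B, for B = {pa} with pa in L, are all the sequences over U.
   Calls are static: executing q is executing its unfolded version. *)
Definition unfold_calls pa q : seq U :=
  flatten [seq if x == call L then pa else [:: x] | x <- q].

Definition exec_lib pa q : behaviour := exec L (unfold_calls pa q).

(* q may be call-free: if pb is compatible with w and precedes p, then pb is
   itself interposed. *)
Definition interposed f w p pa : set (seq U) :=
  [set q | compatible f (exec_lib pa q) w /\ prog_lt q p]%classic.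

End Teaching.

(** The counting bound *)

Definition calls_min (la lb' i : nat) : int :=
  Num.ceil ((i%:R - lb'%:R) / (la%:R - 1) : rat)%R.

(* u = #|Upsilon|, la and lb' the lengths of pa and pb', imin the least
   unfolded length.  Natural-number division is the floor; the sum over i is
   also empty when lb' = 0 < la < imin, as the truncated subtraction then gives
   the upper limit 1. *)
Definition interposed_bound (u la lb' imin : nat) : nat :=
  \sum_(imin <= i < (1 + (lb' - 1) * la).+1)
    \sum_(0 <= j < (i %/ la).+1 | (calls_min la lb' i <= j%:Z)%R)
      'C(i - la * j + j, j) * (u - 1) ^ (i - j * la).

(* Main.v *)
Require Import Defs.
From HB Require Import structures.
From mathcomp Require Import all_boot all_order all_algebra.
From mathcomp Require Import finmap.
From mathcomp Require Import boolp classical_sets functions cardinality.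
From mathcomp Require Import zify.

(* An interposed program with k instructions, j of them calls, unfolds to a
   program of length i = k - j + j * la. There are 'C(k, j) * (u - 1) ^ (k - j)
   programs with given k and j, where k = i - j * (la - 1) can be read off i
   and j, so it is enough to confine i and j to the ranges of the sum.
   The lower limit on i holds because the unfolding of an interposed program is
   a program of L compatible with wb, hence does not precede pb; in the second
   case, an interposed program moreover contains a call, and is not the single
   call since pa is not compatible with wb; so when la <= 1 there is none.
   The upper limit on i is below la * size pb', since the program of length
   size pb' made of calls only is the last one of this length. *)

Import Order.TTheory GRing.Theory Num.Theory.
Local Open Scope card_scope.

(** Repetitions only lengthen a list, so [s] need not be shown duplicate-free. *)
Lemma card_le_seq (T : choiceType) (A : set T) (s : seq T) n :
  (forall x, A x -> x \in s) -> size s <= n -> A #<= `I_n.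
Proof.
move=> As sn; have /Pinj[g eg] : {in A &, injective (index^~ s)}.
  move=> x y /set_mem Ax /set_mem Ay e.
  by rewrite -(nth_index x (As _ Ax)) e nth_index // As.
rewrite -(card_ge_image g _ (fun _ => id)) -eg; apply: subset_card_le.
by move=> _ [x Ax <-] /=; rewrite (leq_trans _ sn) // index_mem As.
Qed.

Section WordsWithCount.
Context {T : finType}.
Variable c : T.

(** The recursion on the first letter matches Pascal's rule. *)
Fixpoint words_with_count k j : seq (seq T) :=
  match k, j with
  | 0, 0 => [:: [::]]
  | 0, _.+1 => [::]
  | k'.+1, 0 =>
      [seq x :: s | x <- enum (predC1 c), s <- words_with_count k' 0]
  | k'.+1, j'.+1 =>
      [seq c :: s | s <- words_with_count k' j'] ++
      [seq x :: s | x <- enum (predC1 c), s <- words_with_count k' j'.+1]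
  end.

Lemma size_words_with_count k j :
  size (words_with_count k j) = 'C(k, j) * (#|T| - 1) ^ (k - j).
Proof.
elim: k j => [|k IHk] [|j] //=.
  by rewrite size_allpairs -cardE cardC1 -subn1 IHk !bin0 !mul1n !subn0 expnS.
rewrite size_cat size_map size_allpairs -cardE cardC1 -subn1 !IHk binS subSS.
(* For [k <= j] the truncated exponents disagree, but ['C(k, j.+1)] vanishes. *)
have [ltjk|lekj] := ltnP j k; last first.
  by rewrite (@bin_small k j.+1) // mul0n muln0 addn0.
by rewrite mulnDl addnC mulnCA -expnS -subSn // subSS.
Qed.

Lemma mem_words_with_count (q : seq T) :
  q \in words_with_count (size q) (count_mem c q).
Proof.
elim: q => [|x q IHq] //=; have [->|xc] := eqVneq x c.
  by rewrite mem_cat map_f.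
have xq : x :: q \in [seq x :: s | x <- enum (predC1 c),
                        s <- words_with_count (size q) (count_mem c q)].
  by apply/allpairsP; exists (x, q); rewrite mem_enum.
by move: xq; case: (count_mem c q) => //= j; rewrite mem_cat orbC => ->.
Qed.

End WordsWithCount.

Lemma calls_min_le la n i j :
  1 < la -> i <= n + j * (la - 1) -> (calls_min la n i <= j%:Z)%R.
Proof.
move=> la1 le_i; rewrite ceil_le_int ler_pdivrMr ?subr_gt0 ?ltr1n //.
by rewrite lerBlDl -(natrB _ (ltnW la1)) -natrM -natrD ler_nat.
Qed.

Section Unfolding.
Context {d : Order.disp_t} {U : finOrderType d} (L : language U).
Implicit Types p q pa : seq U.

(** Each call trades one instruction for [size pa]; adding the call count on the left avoids a
    truncated subtraction. *)
Lemma size_unfold_calls pa q :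
  size (unfold_calls L pa q) + count_mem (call L) q =
  size q + count_mem (call L) q * size pa.
Proof.
elim: q => [|x q IHq] //; rewrite /unfold_calls /= size_cat.
by move: IHq; rewrite /unfold_calls; case: (x == _) => /=; lia.
Qed.

Lemma in_L_unfold_calls pa q : in_L L pa -> in_L L (unfold_calls L pa q).
Proof.
move=> Lpa; apply/negP => /flattenP[s /mapP[x _ ->]].
by case: (eqVneq x) => [_|xc]; [apply/negP|rewrite inE eq_sym (negPf xc)].
Qed.

Lemma unfold_calls_id pa q : in_L L q -> unfold_calls L pa q = q.
Proof.
elim: q => [|x q IHq] //; rewrite /in_L inE negb_or eq_sym => /andP[xc /IHq IH].
by rewrite /unfold_calls /= (negPf xc) /=; congr cons.
Qed.

Lemma prog_lt_size p q : prog_lt p q -> size p <= size q.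
Proof. by case/orP=> [/ltnW//|/andP[/eqP->]]. Qed.

Lemma prog_lt_le_trans p q r :
  prog_lt q p -> ~~ prog_lt r p -> prog_lt q r.
Proof.
rewrite /prog_lt negb_or -leqNgt => /orP[ltqp|/andP[/eqP sqp ltqp]] /andP[lepr].
  by rewrite (leq_trans ltqp).
rewrite sqp; case: (ltngtP (size p) (size r)) lepr => //= spr _.
by rewrite -leNgt; exact: lt_le_trans.
Qed.

Lemma count_call_prog_lt p q :
  prog_lt q p -> count_mem (call L) q < size p.
Proof.
case/orP => [|/andP[/eqP sqp]]; first exact/leq_ltn_trans/count_size.
rewrite -sqp ltn_neqAle count_size andbT => ltqp.
(* Were [q] made of calls only, it would be lexicographically last among the programs of its
   length. *)
apply: contraTneq ltqp => /eqP; rewrite -all_count => callq.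
rewrite -leNgt.
elim: q p sqp callq => [|x q IHq] [|y p] //= [sqp] /andP[/eqP-> callq].
rewrite lexi_cons call_last /=; apply/implyP => _; exact: IHq.
Qed.

Lemma interposed_card_le f w p pa imin :
  1 < size pa ->
  (forall q, interposed L f w p pa q -> imin <= size (unfold_calls L pa q)) ->
  interposed L f w p pa #<=
    `I_(interposed_bound #|U| (size pa) (size p) imin).
Proof.
set la := size pa; set n := size p => la1 ge_imin.
pose js i := [seq j <- index_iota 0 (i %/ la).+1 |
                (calls_min la n i <= j%:Z)%R].
(* This list mirrors the double sum, so its size is bounded term by term. *)
pose s := flatten
  [seq flatten [seq words_with_count (call L) (i - la * j + j) j | j <- js i]
     | i <- index_iota imin (1 + (n - 1) * la).+1].
suff mem_s (q : seq U) : interposed L f w p pa q -> q \in s.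
  apply: (@card_le_seq _ _ s) => //.
  rewrite /interposed_bound size_flatten /shape -map_comp sumnE big_map.
  apply: leq_sum => i _ /=.
  rewrite size_flatten /shape -map_comp sumnE big_map big_filter.
  apply: leq_sum => j _ /=.
  by rewrite size_words_with_count addnK (mulnC la).
move=> Iq; have ge_i := ge_imin q Iq; have [_ ltqp] := Iq.
have le_qn := prog_lt_size _ _ ltqp; have lt_jn := count_call_prog_lt _ _ ltqp.
have le_jq : count_mem (call L) q <= size q by exact: count_size.
have Ei := size_unfold_calls pa q.
set i := size (unfold_calls L pa q) in ge_i Ei.
set j := count_mem (call L) q in lt_jn le_jq Ei.
rewrite -/la in Ei.
(* The difference [i - j * la] counts the non-call instructions of [q], so it does not truncate. *)
have le_jla : j * la <= i by lia.
apply/flatten_mapP; exists i.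
  rewrite mem_index_iota ge_i /= ltnS.
  (* Then [i = size q + j * (la - 1)] is at most [n + (n - 1) * (la - 1) = 1 + (n - 1) * la]. *)
  have : j <= n - 1 by lia.
  nia.
apply/flatten_mapP; exists j.
  rewrite mem_filter mem_index_iota /= ltnS leq_divRL ?le_jla ?andbT; last lia.
  apply: calls_min_le => //; rewrite mulnBr muln1; nia.
have -> : i - la * j + j = size q by rewrite mulnC; lia.
exact: mem_words_with_count.
Qed.

Lemma learner_size_unfold_calls f w p pa q :
  learner L f w p -> in_L L pa -> compatible L f (exec_lib L pa q) w ->
  size p <= size (unfold_calls L pa q).
Proof.
move=> [_ _ first_p] Lpa qw.
have := first_p _ (in_L_unfold_calls _ q Lpa) qw.
by rewrite /prog_lt negb_or -leqNgt => /andP[].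
Qed.

End Unfolding.

Theorem theorem3 (d : Order.disp_t) (U : finOrderType d) (L : language U)
    (E : example_coding) (f : nat -> nat) (wa wb : example_set)
    (pa pb pb' : seq U) :
  teaching_book L E f wa pa ->
  teaching_book L E f wb pb ->
  ~ compatible L f (exec L pa) wb ->
  denotation (exec_lib L pa pb') =1 denotation (exec L pb) ->
  compatible L f (exec_lib L pa pb') wb ->
  ((1 < size pa)%N -> (size pa < size pb)%N ->
     interposed L f wb pb' pa #<=
       `I_(interposed_bound #|U| (size pa) (size pb') (size pb))) /\
  ((size pb <= size pa)%N -> ~~ prog_lt pb pb' ->
     interposed L f wb pb' pa #<=
       `I_(interposed_bound #|U| (size pa) (size pb') (size pa + 1))).
Proof.
move=> [ca [_ _ [Lpa _ _] _]] [cb [_ _ first_pb _]] pa_wb _ _.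
split=> [la1 _|lela pb'_pb].
  apply: interposed_card_le => // q [qwb _].
  exact: (learner_size_unfold_calls L f wb).
have le_pb' : size pb' <= size pb.
  by move: pb'_pb; rewrite /prog_lt negb_or -leqNgt => /andP[].
have has_call q : interposed L f wb pb' pa q ->
    0 < count_mem (call L) q /\ 1 < size q.
  move=> [qwb ltq].
  have callq : call L \in q.
    (* A call-free [q] unfolds to itself; if [pb'] does not come after [pb], then [q] precedes [pb],
       against the minimality of [pb]. *)
    apply: contraNT pb'_pb => Lq; have [_ _ /(_ _ Lq)] := first_pb.
    rewrite /exec_lib unfold_calls_id // in qwb.
    by move=> /(_ qwb); apply: contraNT; exact: prog_lt_le_trans.
  split; first by rewrite -has_count has_pred1.
  case: q callq qwb {ltq} => [|x [|y q]] //; rewrite inE => /eqP <- qwb.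
  case: pa_wb; move: qwb.
  by rewrite /exec_lib /unfold_calls /= eqxx cats0.
have [la1|la1] := ltnP 1 (size pa).
  apply: interposed_card_le => // q /has_call[callq q1].
  (* One call and two instructions force an unfolded length of at least [2 + (size pa - 1)]. *)
  have := size_unfold_calls L pa q; nia.
(* Here [size q <= size pb' <= size pb <= size pa <= 1] contradicts [1 < size q]. *)
apply: (@card_le_seq _ _ [::]) => // q Iq.
have [_ q1] := has_call q Iq; have [_ /(prog_lt_size _ _)] := Iq; lia.
Qed.
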